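(* Consider the continuous-time LQR problem with data $A\in\mathbb{R}^{m\times m}$, $B\in\mathbb{R}^{m\times r}$, and block diagonal symmetric positive definite $Q\in\mathbb{R}^{m\times m}$, $R\in\mathbb{R}^{r\times r}$, decomposed into $n$ subsystems, and suppose that $(A^{(i)}(F),B^{(i)})$ is controllable for at least one $F\in\mathbb{R}^{r\times m}$ and one $i\in\{1,\dots,n\}$. Fix a norm $\|\cdot\|$ on $\mathbb{R}^{r\times m}$. Then the split optimal policy iteration converges locally quadratically: there exist $\delta>0$ and $C>0$ such that for every $F^0\in\mathbb{R}^{r\times m}$ and every starting subsystem $i$ for which $(A^{(i)}(F^0),B^{(i)})$ is controllable, the iterates $(F^k)_{k\ge0}$ of the split optimal policy iteration started with $F^0$ and updating subsystem $i$ first satisfy, for every $k\ge 0$ with $\|F^k-F^{\mathrm{opt}}\|<\delta$, $$\|F^{k+n}-F^{\mathrm{opt}}\|\le C\,\|F^k-F^{\mathrm{opt}}\|^2 .$$ In particular $C$ is independent of the $F^k$.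
   Context: Continuous-time LQR problem: the system is $\dot x(t)=Ax(t)+Bu(t)$ with accumulated cost $\int_0^\infty x(t)^{T}Qx(t)+u(t)^{T}Ru(t)\,dt$ to be minimized. The optimal feedback is $u=F^{\mathrm{opt}}x$ with $F^{\mathrm{opt}}=-R^{-1}B^{T}P^{\mathrm{opt}}$, where $P^{\mathrm{opt}}$ is the unique symmetric positive definite solution of $A^{T}P+PA-PBR^{-1}B^{T}P+Q=0$. Subsystems: the inputs are partitioned as $r=r_1+\dots+r_n$ and the states as $m=m_1+\dots+m_n$; $R$ is block diagonal with blocks of sizes $r_1,\dots,r_n$ and $Q$ is block diagonal with blocks of sizes $m_1,\dots,m_n$. For $i=1,\dots,n$, $\Pi_i\in\mathbb{R}^{r\times r_i}$ is the block column matrix whose $i$-th block is the identity and whose other blocks are $0$. For $F\in\mathbb{R}^{r\times m}$ put $$A^{(i)}(F)=A+B(I-\Pi_i\Pi_i^{T})F,\quad B^{(i)}=B\Pi_i,$$ $$Q^{(i)}(F)=Q+F^{T}(I-\Pi_i\Pi_i^{T})R(I-\Pi_i\Pi_i^{T})F,\quad R^{(i)}=\Pi_i^{T}R\Pi_i .$$ Update of subsystem $i$: given $F$, let $P^{\mathrm{new}}$ be the unique symmetric positive definite solution of the Riccati equation above with $(A,B,Q,R)$ replaced by $(A^{(i)}(F),B^{(i)},Q^{(i)}(F),R^{(i)})$. The updated matrix $g^i(F)=F^{\mathrm{new}}$ is defined by $\Pi_i^{T}F^{\mathrm{new}}=-(R^{(i)})^{-1}(B^{(i)})^{T}P^{\mathrm{new}}$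 and $(I-\Pi_i\Pi_i^{T})F^{\mathrm{new}}=(I-\Pi_i\Pi_i^{T})F$. Split optimal policy iteration started at $F^0$ with subsystem $i$ first: $F^{k+1}=g^{i_k}(F^k)$ for $k\ge 0$, where $i_0=i$ and the indices sweep cyclically through the subsystems ($i_{k+1}=i_k+1$ if $i_k<n$, and $i_{k+1}=1$ if $i_k=n$). Thus $F^{k+n}$ arises from $F^k$ by one full cycle in which each subsystem is updated exactly once. *)

(* Defs.v *)
From HB Require Import structures.
From mathcomp Require Import all_boot all_order all_algebra.
From mathcomp Require Import boolp classical_sets reals.

Set Implicit Arguments.
Unset Strict Implicit.
Unset Printing Implicit Defensive.

Import Order.TTheory GRing.Theory Num.Theory.
Local Open Scope ring_scope.

Definition posdefmx (K : realType) (m : nat) (M : 'M[K]_m) : Prop :=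
  M^T = M /\ forall x : 'cV[K]_m, x != 0 -> 0 < (x^T *m M *m x) 0 0.

Definition block_diagonal (K : realType) (n : nat) (p : 'I_n -> nat)
    (M : 'M[K]_(\sum_i p i)) : Prop :=
  exists D : forall i, 'M[K]_(p i), M = \mxdiag_i D i.

Definition is_norm (K : realType) (r m : nat) (N : 'M[K]_(r, m) -> K) : Prop :=
  [/\ forall X, N X = 0 -> X = 0,
      forall (a : K) X, N (a *: X) = `|a| * N X
    & forall X Y, N (X + Y) <= N X + N Y].

(* Controllability of the pair (A, B) is Kalman's rank condition: the matrix
   [B, A B, ..., A^(m-1) B] has rank m. *)
Definition controllable (K : realType) (m r : nat)
    (A : 'M[K]_m) (B : 'M[K]_(m, r)) : Prop :=
  \rank (\mxrow_(k < m) (A ^+ k *m B)) = m.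

Definition riccati (K : realType) (m r : nat) (A : 'M[K]_m) (B : 'M[K]_(m, r))
    (Q : 'M[K]_m) (R : 'M[K]_r) (P : 'M[K]_m) : Prop :=
  A^T *m P + P *m A - P *m B *m invmx R *m B^T *m P + Q = 0.

(* The symmetric positive definite solution of the Riccati equation. As for
   any definite description by [xget], the value is meaningful when such a
   solution exists and is unique, and it is the dummy value 0 when none exists. *)
Definition riccati_sol (K : realType) (m r : nat) (A : 'M[K]_m)
    (B : 'M[K]_(m, r)) (Q : 'M[K]_m) (R : 'M[K]_r) : 'M[K]_m :=
  xget 0 [set P | posdefmx P /\ riccati A B Q R P]%classic.

Definition lqr_gain (K : realType) (m r : nat) (A : 'M[K]_m)
    (B : 'M[K]_(m, r)) (Q : 'M[K]_m) (R : 'M[K]_r) : 'M[K]_(r, m) :=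
  - (invmx R *m B^T *m riccati_sol A B Q R).

(* Pi_i, obtained as the i-th block column of the identity matrix. *)
Definition block_inj (K : realType) (n : nat) (rs : 'I_n -> nat) (i : 'I_n) :
    'M[K]_(\sum_j rs j, rs i) :=
  submxrow 1%:M i.

Lemma block_inj_diag (K : realType) (n : nat) (rs : 'I_n -> nat) (i : 'I_n) :
  submxcol (block_inj K rs i) i = 1%:M.
Proof.
by rewrite -submxblockEh -mxdiagZ /mxdiag mxblockK eqxx conform_mx_id.
Qed.

Lemma block_inj_offdiag (K : realType) (n : nat) (rs : 'I_n -> nat)
    (i j : 'I_n) (ne_ji : j != i) :
  submxcol (block_inj K rs i) j = 0.
Proof. by rewrite -submxblockEh -mxdiagZ /mxdiag mxblockK (negPf ne_ji). Qed.

(* I - Pi_i Pi_i^T *)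
Definition block_compl (K : realType) (n : nat) (rs : 'I_n -> nat)
    (i : 'I_n) : 'M[K]_(\sum_j rs j) :=
  1%:M - block_inj K rs i *m (block_inj K rs i)^T.

Definition subA (K : realType) (n : nat) (rs : 'I_n -> nat) (m : nat)
    (A : 'M[K]_m) (B : 'M[K]_(m, \sum_j rs j)) (i : 'I_n)
    (F : 'M[K]_(\sum_j rs j, m)) : 'M[K]_m :=
  A + B *m block_compl K rs i *m F.

Definition subB (K : realType) (n : nat) (rs : 'I_n -> nat) (m : nat)
    (B : 'M[K]_(m, \sum_j rs j)) (i : 'I_n) : 'M[K]_(m, rs i) :=
  B *m block_inj K rs i.

Definition subQ (K : realType) (n : nat) (rs : 'I_n -> nat) (m : nat)
    (Q : 'M[K]_m) (R : 'M[K]_(\sum_j rs j)) (i : 'I_n)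
    (F : 'M[K]_(\sum_j rs j, m)) : 'M[K]_m :=
  Q + F^T *m block_compl K rs i *m R *m block_compl K rs i *m F.

Definition subR (K : realType) (n : nat) (rs : 'I_n -> nat)
    (R : 'M[K]_(\sum_j rs j)) (i : 'I_n) : 'M[K]_(rs i) :=
  (block_inj K rs i)^T *m R *m block_inj K rs i.

Definition sub_gain (K : realType) (n : nat) (rs : 'I_n -> nat) (m : nat)
    (A : 'M[K]_m) (B : 'M[K]_(m, \sum_j rs j)) (Q : 'M[K]_m)
    (R : 'M[K]_(\sum_j rs j)) (i : 'I_n) (F : 'M[K]_(\sum_j rs j, m)) :
    'M[K]_(rs i, m) :=
  lqr_gain (subA A B i F) (subB B i) (subQ Q R i F) (subR R i).

(* g^i(F): rows of block i are replaced by the gain of subsystem i, the other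
   rows are kept; [split_updateP] gives the two defining equations. *)
Definition split_update (K : realType) (n : nat) (rs : 'I_n -> nat) (m : nat)
    (A : 'M[K]_m) (B : 'M[K]_(m, \sum_j rs j)) (Q : 'M[K]_m)
    (R : 'M[K]_(\sum_j rs j)) (i : 'I_n) (F : 'M[K]_(\sum_j rs j, m)) :
    'M[K]_(\sum_j rs j, m) :=
  block_inj K rs i *m sub_gain A B Q R i F + block_compl K rs i *m F.

Lemma block_injK (K : realType) (n : nat) (rs : 'I_n -> nat) (i : 'I_n) :
  (block_inj K rs i)^T *m block_inj K rs i = 1%:M.
Proof.
by rewrite tr_submxrow trmx1 submxcol_mul mul1mx block_inj_diag.
Qed.

Lemma split_updateP (K : realType) (n : nat) (rs : 'I_n -> nat) (m : nat)
    (A : 'M[K]_m) (B : 'M[K]_(m, \sum_j rs j)) (Q : 'M[K]_m)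
    (R : 'M[K]_(\sum_j rs j)) (i : 'I_n) (F G : 'M[K]_(\sum_j rs j, m)) :
  G = split_update A B Q R i F <->
  (block_inj K rs i)^T *m G = sub_gain A B Q R i F /\
  block_compl K rs i *m G = block_compl K rs i *m F.
Proof.
rewrite /split_update; set X := sub_gain _ _ _ _ _ _.
have E H : block_compl K rs i *m H
    = H - block_inj K rs i *m ((block_inj K rs i)^T *m H).
  by rewrite /block_compl mulmxBl mul1mx mulmxA.
split=> [->|[<- <-]]; last by rewrite E addrC subrK.
have PX : (block_inj K rs i)^T *m
    (block_inj K rs i *m X + block_compl K rs i *m F) = X.
  by rewrite mulmxDr E mulmxBr !mulmxA block_injK !mul1mx subrr addr0.
by split=> //; rewrite [LHS]E PX addrC addKr.
Qed.

(* [ordS] is the cyclic successor on 'I_n, so subsystem [iter k (@ordS n) i] is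
   the one updated at step k. *)
Fixpoint split_iter (K : realType) (n : nat) (rs : 'I_n -> nat) (m : nat)
    (A : 'M[K]_m) (B : 'M[K]_(m, \sum_j rs j)) (Q : 'M[K]_m)
    (R : 'M[K]_(\sum_j rs j)) (i : 'I_n) (F0 : 'M[K]_(\sum_j rs j, m))
    (k : nat) : 'M[K]_(\sum_j rs j, m) :=
  if k is k'.+1 then
    split_update A B Q R (iter k' (@ordS n) i) (split_iter A B Q R i F0 k')
  else F0.

(* Main.v *)
Require Import Defs.
From HB Require Import structures.
From mathcomp Require Import all_boot all_order all_algebra.
From mathcomp Require Import boolp classical_sets reals.
From mathcomp Require Import topology normedtype sequences derive.
From mathcomp Require Import ring lra.

Set Implicit Arguments.
Unset Strict Implicit.
Unset Printing Implicit Defensive.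

Import Order.TTheory GRing.Theory Num.Theory.
Import numFieldNormedType.Exports.
Local Open Scope classical_set_scope.
Local Open Scope ring_scope.

(** Write Popt for the positive definite Riccati solution and Fopt for the optimal
    gain. Completing the square in the Riccati equation gives, for every gain F,

      (A + BF)^T Popt + Popt (A + BF) = - Q - F^T R F + (F - Fopt)^T R (F - Fopt),

    which is [riccati_feedback]; the deviation F - Fopt enters only quadratically.
    For F near Fopt, the right-hand side is negative definite, so Popt itself
    certifies that A + BF is stable. The update of subsystem i therefore starts
    from a stabilizing gain, and the Riccati equation of that subsystem has a
    positive definite solution P'. This P' satisfies the same kind of identity
    for all gains that agree with F outside block i ([split_update_feedback]).
    Comparing the two identities along the updated loop gives Popt <= P', and along
    the loop A + BF it gives P' <= (1 + O(|F - Fopt|^2)) Popt. Hence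
    P' - Popt = O(|F - Fopt|^2) ([sub_value_quadratic]). As R is block diagonal, the
    new block i of the gain and block i of Fopt are the same linear function of P'
    and of Popt, so the updated block has an error of second order
    ([split_update_quadratic]). The other blocks stay as they are, and after a
    full cycle each block has been updated once ([cycle_quadratic]).

    Stability means here the existence of a quadratic Lyapunov function; no
    exponentials, spectra or improper integrals occur. The basic comparison
    principle is [stable_lyap_psd]: for stable A, a symmetric P with
    A^T P + P A <= 0 is positive semidefinite. From it follow the unique
    solvability of Lyapunov equations, the stabilizability of controllable pairs
    ([controllable_stabilizable]) and, by the monotone convergence of policy
    iteration, the solvability of the Riccati equation for stabilizable pairs
    ([riccati_exists]).

    All estimates use the entrywise maximum norm; an arbitrary norm is reached
    at the end through the equivalence of norms ([mx_norm_equiv]). *)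

(** * Quadratic forms and definite matrices *)

Definition bform (K : realType) (m n : nat) (M : 'M[K]_(m, n))
    (x : 'cV[K]_m) (y : 'cV[K]_n) : K := (x^T *m M *m y) 0 0.

Notation qform M x := (bform M x x).

Lemma bformD (K : realType) m n (M N : 'M[K]_(m, n)) x y :
  bform (M + N) x y = bform M x y + bform N x y.
Proof. by rewrite /bform mulmxDr mulmxDl mxE. Qed.

Lemma bformN (K : realType) m n (M : 'M[K]_(m, n)) x y :
  bform (- M) x y = - bform M x y.
Proof. by rewrite /bform mulmxN mulNmx mxE. Qed.

Lemma bformZ (K : realType) m n (c : K) (M : 'M[K]_(m, n)) x y :
  bform (c *: M) x y = c * bform M x y.
Proof. by rewrite /bform -scalemxAr -scalemxAl mxE. Qed.

Lemma bform0 (K : realType) m n x y : bform (0 : 'M[K]_(m, n)) x y = 0.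
Proof. by rewrite /bform mulmx0 mul0mx mxE. Qed.

Lemma bformDl (K : realType) m n (M : 'M[K]_(m, n)) x x' y :
  bform M (x + x') y = bform M x y + bform M x' y.
Proof. by rewrite /bform linearD /= !mulmxDl mxE. Qed.

Lemma bformNl (K : realType) m n (M : 'M[K]_(m, n)) x y :
  bform M (- x) y = - bform M x y.
Proof. by rewrite /bform linearN /= !mulNmx mxE. Qed.

Lemma bformZl (K : realType) m n (M : 'M[K]_(m, n)) c x y :
  bform M (c *: x) y = c * bform M x y.
Proof. by rewrite /bform linearZ /= -!scalemxAl mxE. Qed.

Lemma bformDr (K : realType) m n (M : 'M[K]_(m, n)) x y y' :
  bform M x (y + y') = bform M x y + bform M x y'.
Proof. by rewrite /bform !mulmxDr mxE. Qed.

Lemma bformNr (K : realType) m n (M : 'M[K]_(m, n)) x y :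
  bform M x (- y) = - bform M x y.
Proof. by rewrite /bform !mulmxN mxE. Qed.

Lemma bformZr (K : realType) m n (M : 'M[K]_(m, n)) c x y :
  bform M x (c *: y) = c * bform M x y.
Proof. by rewrite /bform -!scalemxAr mxE. Qed.

Lemma bform0r (K : realType) m n (M : 'M[K]_(m, n)) x : bform M x 0 = 0.
Proof. by rewrite /bform mulmx0 mxE. Qed.

Definition bformE := (bformD, bformN, bformDl, bformNl, bformDr, bformNr,
  bformZ, bformZl, bformZr).

Lemma bform_tr (K : realType) m n (M : 'M[K]_(m, n)) x y :
  bform M^T x y = bform M y x.
Proof.
rewrite /bform -[in RHS](trmxK (y^T *m M *m x)) [in RHS]mxE.
by rewrite !trmx_mul trmxK mulmxA.
Qed.

Lemma bformC (K : realType) m (M : 'M[K]_m) x y :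
  M^T = M -> bform M x y = bform M y x.
Proof. by move=> sM; rewrite -{1}sM bform_tr. Qed.

Lemma bform_mulr (K : realType) m n p (M : 'M[K]_(m, n)) (Y : 'M[K]_(n, p)) x y :
  bform (M *m Y) x y = bform M x (Y *m y).
Proof. by rewrite /bform !mulmxA. Qed.

Lemma bform_mull (K : realType) m n p (M : 'M[K]_(m, n)) (X : 'M[K]_(m, p)) x y :
  bform (X^T *m M) x y = bform M (X *m x) y.
Proof. by rewrite /bform trmx_mul !mulmxA. Qed.

Lemma bform_delta (K : realType) m n (M : 'M[K]_(m, n)) i j :
  bform M (delta_mx i 0) (delta_mx j 0) = M i j.
Proof. by rewrite /bform trmx_delta -rowE -colE !mxE. Qed.

Lemma bform_sum (K : realType) m n (M : 'M[K]_(m, n)) x y :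
  bform M x y = \sum_i \sum_j x i 0 * M i j * y j 0.
Proof.
rewrite /bform mxE exchange_big; apply: eq_bigr => j _ /=.
by rewrite mxE big_distrl /=; apply: eq_bigr => i _; rewrite mxE.
Qed.

Lemma qform_expand (K : realType) m (M : 'M[K]_m) x y : M^T = M ->
  qform M (x + y) = qform M x + 2 * bform M x y + qform M y.
Proof. by move=> sM; rewrite !bformE (bformC y x sM); ring. Qed.

Lemma sym_qform_eq0 (K : realType) m (M : 'M[K]_m) :
  M^T = M -> (forall x, qform M x = 0) -> M = 0.
Proof.
move=> sM M0; apply/matrixP => i j; rewrite -bform_delta mxE.
have := qform_expand (delta_mx i 0) (delta_mx j 0) sM.
rewrite !M0; lra.
Qed.

Definition psd (K : realType) m (M : 'M[K]_m) : Prop :=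
  M^T = M /\ forall x, 0 <= qform M x.

Lemma posdef_sym (K : realType) m (M : 'M[K]_m) : posdefmx M -> M^T = M.
Proof. by case. Qed.

Lemma posdef_gt0 (K : realType) m (M : 'M[K]_m) x :
  posdefmx M -> x != 0 -> 0 < qform M x.
Proof. by case=> _; apply. Qed.

Lemma posdef_ge0 (K : realType) m (M : 'M[K]_m) x :
  posdefmx M -> 0 <= qform M x.
Proof.
move=> pM; have [->|x0] := eqVneq x 0; last exact/ltW/posdef_gt0.
by rewrite bform0r.
Qed.

Lemma posdef_psd (K : realType) m (M : 'M[K]_m) : posdefmx M -> psd M.
Proof. by move=> pM; split=> [|x]; [exact: posdef_sym|exact: posdef_ge0]. Qed.

Lemma posdef1 (K : realType) m : posdefmx (1%:M : 'M[K]_m).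
Proof.
split=> [|x x0]; first exact: trmx1.
rewrite mulmx1 mxE; under eq_bigr do rewrite mxE.
rewrite lt_neqAle sumr_ge0 ?andbT; last by move=> i _; exact: sqr_ge0.
apply: contra x0; rewrite eq_sym psumr_eq0; last by move=> i _; exact: sqr_ge0.
move/allP => x0; apply/eqP/colP => i; rewrite mxE; apply/eqP.
by have := x0 i (mem_index_enum _); rewrite mulf_eq0 orbb.
Qed.

(** The quadratic polynomial c |-> qform M (x + c y) has no negative value, so
    its discriminant is not positive. *)
Lemma psd_cauchy_schwarz (K : realType) m (M : 'M[K]_m) x y :
  psd M -> bform M x y ^+ 2 <= qform M x * qform M y.
Proof.
move=> [sM M0].
have h c : 0 <= qform M x + 2 * c * bform M x y + c ^+ 2 * qform M y.
  by have := M0 (x + c *: y); rewrite qform_expand // !bformE; lra.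
have := M0 y; rewrite le_eqVlt => /orP[/eqP y0|y0].
  rewrite -y0 mulr0.
  suff -> : bform M x y = 0 by rewrite expr0n.
  apply/eqP/negP => /negP b0.
  (* The polynomial is affine here; at this point its value would be -1. *)
  have := h (- (qform M x + 1) / (2 * bform M x y)).
  rewrite -y0 mulr0 addr0 leNgt => /negP; apply.
  suff -> : qform M x + 2 * (- (qform M x + 1) / (2 * bform M x y)) * bform M x y = -1.
    by rewrite oppr_lt0.
  by field.
(* The minimum of the polynomial. *)
have := h (- (bform M x y) / qform M y).
set a := qform M x; set b := bform M x y; set d := qform M y.
have dn0 : d != 0 by rewrite gt_eqF.
have -> : a + 2 * (- b / d) * b + (- b / d) ^+ 2 * d = (a * d - b ^+ 2) / d.
  by field.
by rewrite pmulr_lge0 ?invr_gt0 // subr_ge0.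
Qed.

(** Cauchy-Schwarz for x and M x bounds |M x|^4 by a multiple of qform M x. *)
Lemma psd_ker (K : realType) m (M : 'M[K]_m) x :
  psd M -> qform M x = 0 -> M *m x = 0.
Proof.
move=> pM x0; apply/eqP/negP => /negP Mx0.
have := posdef_gt0 (posdef1 K m) Mx0.
rewrite -bform_mulr mul1mx (bformC _ _ (proj1 pM)).
suff -> : bform M x (M *m x) = 0 by rewrite ltxx.
have := psd_cauchy_schwarz x (M *m x) pM.
by rewrite x0 mul0r => h; apply/eqP; rewrite -sqrf_eq0 eq_le h sqr_ge0.
Qed.

Lemma unitmx_of_ker0 (K : realType) m (M : 'M[K]_m) :
  (forall x : 'cV_m, M *m x = 0 -> x = 0) -> M \in unitmx.
Proof.
move=> kM; rewrite -unitmx_tr -row_free_unit; apply: inj_row_free => v vM.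
by apply: trmx_inj; rewrite trmx0; apply: kM; rewrite -[M]trmxK -trmx_mul vM trmx0.
Qed.

Lemma psd_ker0_posdef (K : realType) m (M : 'M[K]_m) :
  psd M -> (forall x : 'cV_m, M *m x = 0 -> x = 0) -> posdefmx M.
Proof.
move=> pM kM; split=> [|x x0]; first exact: (proj1 pM).
rewrite lt_neqAle (proj2 pM) andbT; apply: contra x0 => /eqP x0.
by apply/eqP/kM/psd_ker.
Qed.

Lemma posdef_unit (K : realType) m (M : 'M[K]_m) : posdefmx M -> M \in unitmx.
Proof.
move=> pM; apply: unitmx_of_ker0 => x Mx; apply/eqP/negP => /negP x0.
have := posdef_gt0 pM x0; rewrite -[M]mul1mx bform_mulr Mx.
by rewrite bform0r ltxx.
Qed.

Lemma posdef_inv (K : realType) m (M : 'M[K]_m) :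
  posdefmx M -> posdefmx (invmx M).
Proof.
move=> pM; have uM := posdef_unit pM.
split=> [|x x0]; first by rewrite trmx_inv posdef_sym.
have xy : x = M *m (invmx M *m x) by rewrite mulKVmx.
set y := invmx M *m x in xy.
have y0 : y != 0 by apply: contra x0 => /eqP y0; rewrite xy y0 mulmx0.
suff -> : (x^T *m invmx M *m x) 0 0 = qform M y by exact: posdef_gt0.
rewrite -[LHS]/(qform (invmx M) x) xy -bform_mulr mulVmx //.
by rewrite -bform_mull mulmx1 posdef_sym.
Qed.

(** * Bounds by the entrywise maximum norm *)

Lemma le_mx_norm_entry (K : realType) m n (M : 'M[K]_(m, n)) i j :
  `|M i j| <= `|M|.
Proof.
rewrite [leRHS]/Num.norm /= mx_normrE.
by apply/bigmax_geP; right => /=; exists (i, j).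
Qed.

Lemma mx_norm_le (K : realType) m n (M : 'M[K]_(m, n)) c :
  0 <= c -> (forall i j, `|M i j| <= c) -> `|M| <= c.
Proof.
move=> c0 Mc; rewrite [leLHS]/Num.norm /= mx_normrE.
by apply/bigmax_leP; split=> // -[i j] _; apply: Mc.
Qed.

Lemma sum_ord_le (K : realType) n (F : 'I_n -> K) c :
  (forall i, F i <= c) -> \sum_i F i <= n%:R * c.
Proof.
move=> Fc; rewrite (le_trans (ler_sum _ (fun i _ => Fc i))) //.
by rewrite sumr_const card_ord mulr_natl.
Qed.

Lemma mx_norm_tr (K : realType) m n (M : 'M[K]_(m, n)) : `|M^T| = `|M|.
Proof.
have le k p (X : 'M[K]_(k, p)) : `|X^T| <= `|X|.
  by apply: mx_norm_le => // i j; rewrite mxE le_mx_norm_entry.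
by apply/eqP; rewrite eq_le le -{1}[M]trmxK le.
Qed.

Lemma le_sum_term (K : realType) n (F : 'I_n -> K) i :
  (forall j, 0 <= F j) -> F i <= \sum_j F j.
Proof. by move=> F0; rewrite (bigD1 i) //= lerDl sumr_ge0. Qed.

Lemma mx_normM (K : realType) m n p (M : 'M[K]_(m, n)) (N : 'M[K]_(n, p)) :
  `|M *m N| <= n%:R * `|M| * `|N|.
Proof.
apply: mx_norm_le => [|i j]; first by rewrite !mulr_ge0.
rewrite mxE (le_trans (ler_norm_sum _ _ _))//.
rewrite -mulrA sum_ord_le // => k.
by rewrite normrM ler_pM // le_mx_norm_entry.
Qed.

Lemma qform_norm_le (K : realType) m (M : 'M[K]_m) x :
  `|qform M x| <= (m * m)%:R * `|M| * qform 1%:M x.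
Proof.
rewrite bform_sum (le_trans (ler_norm_sum _ _ _))//.
have xx i j : `|x i 0| * `|x j 0| <= qform 1%:M x.
  have -> : qform 1%:M x = \sum_k x k 0 ^+ 2.
    by rewrite /bform mulmx1 mxE; apply: eq_bigr => k _; rewrite mxE.
  have le1 k : `|x k 0| ^+ 2 <= \sum_k x k 0 ^+ 2.
    rewrite real_normK ?num_real // (bigD1 k) //= lerDl sumr_ge0 // => l _.
    exact: sqr_ge0.
  have := le1 i; have := le1 j; have := sqr_ge0 (`|x i 0| - `|x j 0|).
  rewrite sqrrB; lra.
rewrite natrM -!mulrA sum_ord_le // => i.
rewrite (le_trans (ler_norm_sum _ _ _))//.
rewrite sum_ord_le // => j.
rewrite !normrM -mulrA mulrCA ler_pM //; first by rewrite mulr_ge0.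
exact: le_mx_norm_entry.
Qed.

Lemma qform_image_le (K : realType) r m (R : 'M[K]_r) (X : 'M[K]_(r, m)) x :
  qform R (X *m x) <=
    (m * m)%:R * (r%:R * r%:R * `|R|) * `|X| ^+ 2 * qform 1%:M x.
Proof.
rewrite -bform_mulr -bform_mull (le_trans (ler_norm _)) //.
rewrite (le_trans (qform_norm_le _ _)) // ler_wpM2r ?posdef_ge0 //.
  exact: posdef1.
rewrite -[leRHS]mulrA ler_wpM2l // mulmxA (le_trans (mx_normM _ _)) //.
have := mx_normM X^T R; rewrite mx_norm_tr => h.
apply: (@le_trans _ _ (r%:R * (r%:R * `|X| * `|R|) * `|X|)).
  by rewrite ler_wpM2r // ler_wpM2l.
by rewrite expr2 le_eqVlt; apply/orP; left; apply/eqP; ring.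
Qed.

(** Uniform positivity without compactness: Cauchy-Schwarz for M, applied to x
    and M^-1 x, reads |x|^4 <= (x^T M x) (x^T M^-1 x), and the last factor is at
    most a multiple of |x|^2. *)
Lemma posdef_lower (K : realType) m (M : 'M[K]_m) : posdefmx M ->
  exists2 c, 0 < c & forall x, c * qform 1%:M x <= qform M x.
Proof.
move=> pM; have pV := posdef_inv pM; have uM := posdef_unit pM.
set b := (m * m)%:R * `|invmx M| + 1.
have b0 : 0 < b by rewrite ltr_wpDl // mulr_ge0.
exists b^-1; first by rewrite invr_gt0.
move=> x; rewrite mulrC ler_pdivrMr //.
have [->|x0] := eqVneq x 0; first by rewrite !bform0r mul0r.
have x1 := posdef_gt0 (posdef1 K m) x0.
rewrite -(ler_pM2r x1) -expr2.
have := psd_cauchy_schwarz x (invmx M *m x) (posdef_psd pM).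
rewrite -bform_mulr mulmxV // => /le_trans; apply.
rewrite -mulrA ler_wpM2l ?posdef_ge0 //.
have -> : qform M (invmx M *m x) = qform (invmx M) x.
  by rewrite -bform_mull trmx_inv posdef_sym // mulVmx // -bform_mulr mul1mx.
rewrite (le_trans (ler_norm _)) // (le_trans (qform_norm_le _ _)) //.
by rewrite ler_wpM2r ?(ltW x1) // lerDl.
Qed.

(** For a semidefinite M, Cauchy-Schwarz bounds the square of an entry by the
    product of two diagonal entries. *)
Lemma psd_norm_le (K : realType) m (M : 'M[K]_m) c : 0 <= c -> psd M ->
  (forall x, qform M x <= c * qform 1%:M x) -> `|M| <= c.
Proof.
move=> c0 pM Mc; apply: mx_norm_le => // i j.
rewrite -(ler_pXn2r (n := 2)) ?nnegrE // real_normK ?num_real //.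
rewrite -bform_delta (le_trans (psd_cauchy_schwarz _ _ pM)) // expr2.
have d k : qform M (delta_mx k 0) <= c.
  by rewrite (le_trans (Mc _)) // bform_delta mxE eqxx mulr1.
by rewrite ler_pM // (proj2 pM).
Qed.

(** * The Lyapunov equation *)

Definition lyap (K : realType) m (A P : 'M[K]_m) : 'M[K]_m :=
  A^T *m P + P *m A.

(** Over the reals this is equivalent to all eigenvalues of A having negative
    real part. The certificate X is what the proofs produce and consume: it is
    always an explicit matrix such as a policy value or a Riccati solution. *)
Definition stable (K : realType) m (A : 'M[K]_m) : Prop :=
  exists2 X, posdefmx X & forall x, x != 0 -> qform (lyap A X) x < 0.

Lemma tr_lyap (K : realType) m (A P : 'M[K]_m) : (lyap A P)^T = lyap A P^T.
Proof. by rewrite /lyap linearD /= !trmx_mul trmxK addrC. Qed.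

Lemma qform_lyap (K : realType) m (A P : 'M[K]_m) x :
  P^T = P -> qform (lyap A P) x = 2 * bform P x (A *m x).
Proof.
move=> sP; rewrite /lyap bformD bform_mull bform_mulr (bformC (A *m x)) //.
by ring.
Qed.

Lemma lyapD (K : realType) m (A P P' : 'M[K]_m) :
  lyap A (P + P') = lyap A P + lyap A P'.
Proof. by rewrite /lyap mulmxDr mulmxDl addrACA. Qed.

Lemma lyapN (K : realType) m (A P : 'M[K]_m) : lyap A (- P) = - lyap A P.
Proof. by rewrite /lyap mulmxN mulNmx opprD. Qed.

Lemma lyapZ (K : realType) m (A P : 'M[K]_m) c :
  lyap A (c *: P) = c *: lyap A P.
Proof. by rewrite /lyap -scalemxAr -scalemxAl scalerDr. Qed.

(** Let s be the largest number with s X <= P, where X certifies stability. By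
    maximality P - s X is singular, so P y = s X y for some nonzero y; hence
    y^T (A^T P + P A) y = s y^T (A^T X + X A) y, which forces s >= 0. *)
Lemma stable_lyap_psd (K : realType) m (A P : 'M[K]_m) : stable A ->
  P^T = P -> (forall x, qform (lyap A P) x <= 0) -> psd P.
Proof.
move=> [X pX AX] sP AP; split=> // x; rewrite leNgt; apply/negP => Px.
have sX := posdef_sym pX.
have x0 : x != 0.
  by apply: contraTneq Px => ->; rewrite bform0r ltxx.
have Xx := posdef_gt0 pX x0.
pose S := [set l : K | forall y, l * qform X y <= qform P y]%classic.
have S_ub l : S l -> l <= qform P x / qform X x.
  by move=> Sl; rewrite ler_pdivlMr.
have [c c0 cX] := posdef_lower pX.
have S0 : has_sup S.
  split; last by exists (qform P x / qform X x) => l /S_ub.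
  (* P >= - m^2 |P| I and X >= c I. *)
  exists (- ((m * m)%:R * `|P| / c)) => y /=.
  have := qform_norm_le P y; rewrite ler_norml => /andP[+ _].
  apply: le_trans; rewrite mulNr lerN2 [leRHS]mulrAC ler_pdivlMr //.
  by rewrite -[leLHS]mulrA ler_wpM2l ?mulr_ge0 // mulrC.
set s := sup S.
have ss : S s.
  move=> y; have [->|y0] := eqVneq y 0; first by rewrite !bform0r mulr0.
  have Xy := posdef_gt0 pX y0.
  rewrite -ler_pdivlMr //; apply: ge_sup; first by case: S0.
  by move=> l Sl; rewrite ler_pdivlMr.
have s_lt0 : s < 0.
  apply: le_lt_trans (S_ub _ ss) _.
  by rewrite pmulr_llt0 ?invr_gt0.
set M := P - s *: X.
have sM : M^T = M by rewrite /M linearB linearZ /= sP sX.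
have pM : psd M.
  by split=> // y; rewrite /M !bformE subr_ge0.
have [y y0 My] : exists2 y : 'cV[K]_m, y != 0 & M *m y = 0.
  apply: contrapT => nex.
  have /posdef_lower[d d0 dM] : posdefmx M.
    apply: psd_ker0_posdef => // y My; apply/eqP/negP => /negP y0.
    by apply: nex; exists y.
  (* If P - s X >= d I, then s may be increased by e, since e X <= d I. *)
  pose e := d / ((m * m)%:R * `|X| + 1).
  have b0 : 0 < (m * m)%:R * `|X| + 1 by rewrite ltr_wpDl // mulr_ge0.
  have e0 : 0 < e by rewrite divr_gt0.
  suff : s + e <= s by rewrite gerDl leNgt e0.
  apply: ub_le_sup; first by case: S0.
  move=> y /=; rewrite mulrDl -lerBrDl.
  have := dM y; rewrite /M !bformE; apply: le_trans.
  rewrite /e mulrAC ler_pdivrMr // -mulrA ler_wpM2l ?(ltW d0) // mulrC.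
  rewrite (le_trans (ler_norm _)) // (le_trans (qform_norm_le _ _)) //.
  by rewrite ler_wpM2r ?posdef_ge0 ?lerDl //; apply: posdef1.
have Py : P *m y = s *: (X *m y).
  by apply/eqP; rewrite -subr_eq0 scalemxAl -mulmxBl My.
have := AP y; have := AX y y0; rewrite !qform_lyap //.
have -> : bform P y (A *m y) = s * bform X y (A *m y).
  rewrite (bformC y) // (bformC y) // -[P]mul1mx bform_mulr Py.
  by rewrite bformZr -bform_mulr mul1mx.
by move=> h1 h2; have := s_lt0; nra.
Qed.

(** P need not be symmetric, so [stable_lyap_psd] is applied to -M for
    M = P^T X^-1 P: if A^T P + P A = 0, then A^T (-M) + (-M) A is the congruence
    of A^T X + X A by X^-1 P. So M is both positive and negative semidefinite. *)
Lemma stable_lyap_eq0 (K : realType) m (A P : 'M[K]_m) :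
  stable A -> lyap A P = 0 -> P = 0.
Proof.
move=> sA LP; have [X pX AX] := sA.
have sX := posdef_sym pX; have pV := posdef_inv pX; have uX := posdef_unit pX.
have sV := posdef_sym pV.
have PA : P *m A = - (A^T *m P).
  by apply/eqP; rewrite -addr_eq0 addrC -[X in X == _]/(lyap A P) LP.
pose M := P^T *m invmx X *m P.
have qM x : qform M x = qform (invmx X) (P *m x).
  by rewrite /M bform_mulr bform_mull.
have sM : M^T = M by rewrite /M !trmx_mul trmxK sV mulmxA.
have pM : psd M by split=> // x; rewrite qM posdef_ge0.
have nM : psd (- M).
  apply: (stable_lyap_psd sA) => [|x]; first by rewrite linearN /= sM.
  set y := invmx X *m (P *m x).
  have Py : P *m x = X *m y by rewrite /y mulKVmx.
  have -> : qform (lyap A (- M)) x = qform (lyap A X) y.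
    rewrite !qform_lyap ?linearN /= ?sM // bformN /M; congr (_ * _).
    rewrite -mulmxA bform_mull bform_mulr mulmxA PA mulNmx bformNr opprK.
    rewrite -mulmxA Py -bform_mull sX mulmxV // -[LHS]bform_mulr mul1mx.
    by rewrite bform_tr -bform_mull sX bform_mulr.
  have [->|y0] := eqVneq y 0; last exact/ltW/AX.
  by rewrite bform0r.
have P0 (x : 'cV[K]_m) : P *m x = 0.
  apply/eqP/negP => /negP Px0.
  have := posdef_gt0 pV Px0; rewrite -qM ltNge.
  by have := proj2 nM x; rewrite bformN oppr_ge0 => ->.
apply/matrixP => i j; have := P0 (delta_mx j 0); rewrite -colE.
by move/colP/(_ i); rewrite !mxE.
Qed.

(** The Lyapunov operator is an injective endomorphism of a space of finite
    dimension, hence onto; uniqueness makes the solution symmetric. *)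
Lemma stable_lyap_solve (K : realType) m (A W : 'M[K]_m) :
  stable A -> W^T = W -> exists P, P^T = P /\ lyap A P = W.
Proof.
move=> sA sW.
pose L := lin_mulmx A^T + lin_mulmxr A : 'M[K]_(m * m).
have LE u : mxvec u *m L = mxvec (lyap A u).
  by rewrite mulmxDr !mul_vec_lin /= -linearD.
have uL : L \in unitmx.
  rewrite -row_free_unit; apply: inj_row_free => v.
  rewrite -[v]vec_mxK LE => /(congr1 vec_mx); rewrite mxvecK linear0.
  by move/(stable_lyap_eq0 sA) => ->; rewrite linear0.
have [P LP] : exists P, lyap A P = W.
  exists (vec_mx (mxvec W *m invmx L)).
  by apply: (can_inj mxvecK); rewrite -LE vec_mxK mulmxKV.
exists P; split=> //; apply/eqP; rewrite -subr_eq0; apply/eqP.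
by apply: (stable_lyap_eq0 sA); rewrite lyapD lyapN -tr_lyap LP sW subrr.
Qed.

(** * Controllable pairs are stabilizable *)

Lemma qform_gram (K : realType) m n (B : 'M[K]_(m, n)) x :
  qform (B *m B^T) x = qform 1%:M (B^T *m x).
Proof. by rewrite -bform_mull mulmx1 -bform_mulr trmxK. Qed.

(** Bass's construction. For large b the matrix -(A + b I)^T is stable, and
    the solution W of (A + b I) W + W (A + b I)^T = 2 B B^T is semidefinite. Its
    kernel is invariant under A^T and contained in the kernel of B^T, so it is
    trivial by Kalman's condition. With F = - B^T W^-1 one finds
    (A + BF) W + W (A + BF)^T = - 2 b W, so W^-1 certifies stability. *)
Lemma controllable_stabilizable (K : realType) m r (A : 'M[K]_m)
    (B : 'M[K]_(m, r)) :
  controllable A B -> exists F, stable (A + B *m F).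
Proof.
move=> cAB.
pose b := (m * m)%:R * `|A| + 1.
pose L := - (A + b%:M)^T.
have LE y : L *m y = - (A^T *m y) - b *: y.
  by rewrite /L linearD /= tr_scalar_mx mulNmx mulmxDl mul_scalar_mx opprD.
have b0 : 0 < b by rewrite ltr_wpDl // mulr_ge0.
have sL : stable L.
  exists 1%:M; first exact: posdef1.
  move=> x x0; rewrite qform_lyap ?trmx1 // LE !bformE -bform_mulr mul1mx bform_tr.
  have := qform_norm_le A x; rewrite ler_norml => /andP[+ _].
  have := posdef_gt0 (posdef1 K m) x0; rewrite /b.
  set q := qform 1%:M x; set a := _ * `|A|; lra.
have sBB : (- (2 *: (B *m B^T)))^T = - (2 *: (B *m B^T)).
  by rewrite linearN linearZ /= trmx_mul trmxK.
have [W [sW LW]] := stable_lyap_solve sL sBB.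
have BB0 x : 0 <= qform (B *m B^T) x.
  by rewrite qform_gram posdef_ge0 //; apply: posdef1.
have psdW : psd W.
  by apply: (stable_lyap_psd sL) => // x; rewrite LW !bformE oppr_le0 mulr_ge0.
have kerW (x : 'cV_m) : W *m x = 0 -> B^T *m x = 0 /\ W *m (A^T *m x) = 0.
  move=> Wx.
  have Bx : B^T *m x = 0.
    have : qform (lyap L W) x = 0.
      by rewrite qform_lyap // -(bformC _ _ sW) -[W]mul1mx bform_mulr Wx bform0r mulr0.
    rewrite LW !bformE qform_gram => /eqP; rewrite oppr_eq0 mulf_eq0 pnatr_eq0 /=.
    move=> q0; apply/eqP/negP => /negP Bx0.
    by have := posdef_gt0 (posdef1 K r) Bx0; rewrite (eqP q0) ltxx.
  split=> //; have := congr1 (mulmx^~ x) LW.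
  rewrite /lyap mulmxDl -!mulmxA Wx mulmx0 add0r LE mulmxBr -scalemxAr Wx scaler0.
  by rewrite subr0 mulmxN mulNmx -scalemxAl -mulmxA Bx mulmx0 scaler0 => /oppr_inj.
have pW : posdefmx W.
  apply: psd_ker0_posdef => // x Wx.
  have WAx k : W *m ((A ^+ k)^T *m x) = 0.
    elim: k => [|k IH]; first by rewrite expr0 trmx1 mul1mx.
    by rewrite exprSr trmx_mul -mulmxA; apply: (proj2 (kerW _ IH)).
  have rf : row_free (\mxrow_(k < m) (A ^+ k *m B)) by rewrite /row_free cAB.
  apply: trmx_inj; rewrite trmx0; apply/eqP; rewrite -(mulmx_free_eq0 _ rf).
  rewrite mul_mxrow; apply/eqP; rewrite -[RHS](mxrow0 _ (q_ := fun=> r)).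
  apply: eq_mxrow => k; apply: trmx_inj; rewrite trmx0 !trmx_mul trmxK.
  by rewrite -mulmxA (proj1 (kerW _ (WAx k))).
have uW := posdef_unit pW.
have pX := posdef_inv pW; have sX := posdef_sym pX.
(* In the coordinate y = W^-1 x the derivative of the certificate is
   - 2 b y^T W y. *)
exists (- (B^T *m invmx W)); exists (invmx W) => // x x0.
set y := invmx W *m x; have xy : x = W *m y by rewrite /y mulKVmx.
have y0 : y != 0 by apply: contra x0 => /eqP y0; rewrite xy y0 mulmx0.
have := posdef_gt0 pW y0; have : qform (lyap L W) y = - (2 * qform (B *m B^T) y).
  by rewrite LW !bformE.
rewrite !qform_lyap // LE !bformE.
rewrite mulmxN mulmxDl mulNmx bformDr bformNr.
have E z : bform (invmx W) x z = bform 1%:M y z.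
  by rewrite {1}xy -bform_mull sW mulmxV.
have -> : bform (invmx W) x (A *m x) = bform W y (A^T *m y).
  rewrite E -bform_mulr mul1mx [RHS]bformC // -bform_mull trmxK.
  by rewrite bform_mulr -xy.
have -> : bform (invmx W) x (B *m (B^T *m invmx W) *m x) = qform (B *m B^T) y.
  by rewrite E -!mulmxA -/y -bform_mulr mul1mx bform_mulr.
set a := bform W _ _; set c := qform (B *m _) _ => h q0.
have : 0 < b * qform W y by rewrite mulr_gt0.
by move: h; set q := b * _; lra.
Qed.

(** * Completing the square in the Riccati equation *)

Lemma bform_gain (K : realType) m r (B : 'M[K]_(m, r)) (P : 'M[K]_m)
    (R : 'M[K]_r) (G : 'M[K]_(r, m)) x y :
  P^T = P -> R *m G = - (B^T *m P) ->
  bform R y (G *m x) = - bform P x (B *m y).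
Proof. by move=> sP RG; rewrite -bform_mulr RG bformN bform_mull bformC. Qed.

(** The mixed term 2 x^T P B F x equals - 2 (G x)^T R (F x), which completes to
    a square. *)
Lemma qform_lyap_feedback (K : realType) m r (A : 'M[K]_m) (B : 'M[K]_(m, r))
    (P : 'M[K]_m) (R : 'M[K]_r) (F G : 'M[K]_(r, m)) x :
  P^T = P -> R^T = R -> R *m G = - (B^T *m P) ->
  qform (lyap (A + B *m F) P) x = qform (lyap A P) x - qform R (G *m x)
    - qform R (F *m x) + qform R ((F - G) *m x).
Proof.
move=> sP sR RG; rewrite !qform_lyap // mulmxDl mulmxBl !bformE.
rewrite -mulmxA (bformC (G *m x)) // !(bform_gain _ _ sP RG); ring.
Qed.

Definition gain (K : realType) m r (B : 'M[K]_(m, r)) (R : 'M[K]_r)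
  (P : 'M[K]_m) : 'M[K]_(r, m) := - (invmx R *m B^T *m P).

Lemma gainE (K : realType) m r (B : 'M[K]_(m, r)) (R : 'M[K]_r)
    (P : 'M[K]_m) : R \in unitmx -> R *m gain B R P = - (B^T *m P).
Proof. by move=> uR; rewrite /gain mulmxN -!mulmxA mulKVmx. Qed.

(** The defect of P in the Riccati equation: [riccati A B Q R P] says that it
    vanishes. *)
Definition riccati_res (K : realType) m r (A : 'M[K]_m) (B : 'M[K]_(m, r))
    (Q : 'M[K]_m) (R : 'M[K]_r) (P : 'M[K]_m) : 'M[K]_m :=
  A^T *m P + P *m A - P *m B *m invmx R *m B^T *m P + Q.

Lemma tr_riccati_res (K : realType) m r (A : 'M[K]_m) (B : 'M[K]_(m, r))
    (Q : 'M[K]_m) (R : 'M[K]_r) (P : 'M[K]_m) :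
  Q^T = Q -> R^T = R -> P^T = P ->
  (riccati_res A B Q R P)^T = riccati_res A B Q R P.
Proof.
move=> sQ sR sP; rewrite /riccati_res !(linearD, linearN) /= !trmx_mul !trmxK.
by rewrite trmx_inv sQ sR sP !mulmxA [P *m A + _]addrC.
Qed.

Lemma qform_riccati_res (K : realType) m r (A : 'M[K]_m) (B : 'M[K]_(m, r))
    (Q : 'M[K]_m) (R : 'M[K]_r) (P : 'M[K]_m) x :
  R^T = R -> R \in unitmx -> P^T = P ->
  qform (riccati_res A B Q R P) x =
    qform (lyap A P) x - qform R (gain B R P *m x) + qform Q x.
Proof.
move=> sR uR sP; rewrite /riccati_res -/(lyap A P) 2!bformD bformN.
congr (_ - _ + _); rewrite (bform_gain _ _ sP (gainE _ _ uR)).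
by rewrite /gain mulNmx mulmxN bformNr opprK -!mulmxA bform_mulr -!mulmxA.
Qed.

(** The identity behind all estimates. For F = gain B R P it is the Lyapunov
    equation of the closed loop; for other gains the excess is a square. *)
Lemma riccati_feedback (K : realType) m r (A : 'M[K]_m) (B : 'M[K]_(m, r))
    (Q : 'M[K]_m) (R : 'M[K]_r) (P : 'M[K]_m) (F : 'M[K]_(r, m)) x :
  posdefmx R -> P^T = P -> riccati A B Q R P ->
  qform (lyap (A + B *m F) P) x =
    qform R ((F - gain B R P) *m x) - qform Q x - qform R (F *m x).
Proof.
move=> pR sP ric; have sR := posdef_sym pR; have uR := posdef_unit pR.
rewrite (@qform_lyap_feedback _ _ _ _ _ _ R F (gain B R P)) ?gainE //.
have := qform_riccati_res A B Q x sR uR sP.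
rewrite (_ : riccati_res _ _ _ _ _ = 0) // bform0 => h.
by lra.
Qed.

(** * Monotone limits of matrices *)

(** Entrywise convergence, for which the continuity of the matrix product is
    immediate from that of the scalar operations. *)
Definition mxcvg (K : realType) m n (u : nat -> 'M[K]_(m, n))
    (M : 'M[K]_(m, n)) : Prop :=
  forall i j, (fun k => u k i j) @ \oo --> M i j.

Lemma mxcvg_cst (K : realType) m n (M : 'M[K]_(m, n)) : mxcvg (fun=> M) M.
Proof. by move=> i j; apply: cvg_cst. Qed.

Lemma mxcvgD (K : realType) m n (u v : nat -> 'M[K]_(m, n)) M N :
  mxcvg u M -> mxcvg v N -> mxcvg (fun k => u k + v k) (M + N).
Proof.
move=> uM vN i j; rewrite mxE (_ : (fun _ => _) = (fun k => u k i j + v k i j)).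
  exact: cvgD.
by apply/funext => k; rewrite mxE.
Qed.

Lemma mxcvgN (K : realType) m n (u : nat -> 'M[K]_(m, n)) M :
  mxcvg u M -> mxcvg (fun k => - u k) (- M).
Proof.
move=> uM i j; rewrite mxE (_ : (fun _ => _) = (fun k => - u k i j)).
  exact: cvgN.
by apply/funext => k; rewrite mxE.
Qed.

Lemma mxcvgM (K : realType) m n p (u : nat -> 'M[K]_(m, n))
    (v : nat -> 'M[K]_(n, p)) M N :
  mxcvg u M -> mxcvg v N -> mxcvg (fun k => u k *m v k) (M *m N).
Proof.
move=> uM vN i j; rewrite mxE.
rewrite (_ : (fun _ => _) = (fun k => \sum_l u k i l * v k l j)).
  by apply: cvg_big => [|l _]; [exact: add_continuous|exact: cvgM].
by apply/funext => k; rewrite mxE.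
Qed.

Lemma mxcvg_tr (K : realType) m n (u : nat -> 'M[K]_(m, n)) M :
  mxcvg u M -> mxcvg (fun k => (u k)^T) M^T.
Proof.
move=> uM i j; rewrite mxE (_ : (fun _ => _) = (fun k => u k j i)).
  exact: uM.
by apply/funext => k; rewrite mxE.
Qed.

Lemma mxcvg_shift (K : realType) m n (u : nat -> 'M[K]_(m, n)) M :
  mxcvg u M -> mxcvg (fun k => u k.+1) M.
Proof. by move=> uM i j; have := uM i j; rewrite -(cvg_shiftS (fun k => u k i j)). Qed.

Lemma mxcvg_bform (K : realType) m n (u : nat -> 'M[K]_(m, n)) M x y :
  mxcvg u M -> (fun k => bform (u k) x y) @ \oo --> bform M x y.
Proof.
move=> uM.
have h : mxcvg (fun k => x^T *m u k *m y) (x^T *m M *m y).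
  by apply: mxcvgM; [apply: mxcvgM|]; rewrite //; apply: mxcvg_cst.
exact: h.
Qed.

(** Each quadratic form decreases and is bounded below, so it converges; the
    entries are recovered from the forms by polarization. *)
Lemma psd_decreasing_cvg (K : realType) m (u : nat -> 'M[K]_m) :
  (forall k, psd (u k)) -> (forall k, psd (u k - u k.+1)) ->
  exists2 M, psd M & mxcvg u M.
Proof.
move=> u0 du.
have cq x : cvgn (fun k => qform (u k) x).
  apply: nonincreasing_is_cvgn.
    apply/nonincreasing_seqP => k; rewrite -subr_ge0 -bformN -bformD.
    exact: (proj2 (du k)).
  by exists 0 => _ [k _ <-]; apply: (proj2 (u0 k)).
have ce i j : cvgn (fun k => u k i j).
  have -> : (fun k => u k i j) = (fun k => 2^-1 *
      (qform (u k) (delta_mx i 0 + delta_mx j 0)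
       - qform (u k) (delta_mx i 0) - qform (u k) (delta_mx j 0))).
    apply/funext => k; rewrite qform_expand; last exact: (proj1 (u0 k)).
    by rewrite -bform_delta; lra.
  apply: is_cvgM; first exact: is_cvg_cst.
  by apply: is_cvgB => //; apply: is_cvgB.
pose M := \matrix_(i, j) limn (fun k => u k i j).
have uM : mxcvg u M by move=> i j; rewrite mxE; apply: ce.
exists M => //; split.
  apply/matrixP => i j; rewrite !mxE; congr (limn _); apply/funext => k.
  by rewrite -{1}(proj1 (u0 k)) mxE.
move=> x; have := @mxcvg_bform _ _ _ _ _ x x uM => /cvg_lim <- //.
apply: limr_ge; first exact: cq.
by apply: nearW => k; apply: (proj2 (u0 k)).
Qed.

(** * Policy iteration solves the Riccati equation *)

(** The cost matrix of a stabilizing gain F: the value x^T P x is the cost of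
    the feedback u = F x started at x. *)
Definition policy_value (K : realType) m r (A : 'M[K]_m) (B : 'M[K]_(m, r))
    (Q : 'M[K]_m) (R : 'M[K]_r) (F : 'M[K]_(r, m)) : 'M[K]_m :=
  xget 0 [set P : 'M[K]_m |
    P^T = P /\ lyap (A + B *m F) P = - (Q + F^T *m R *m F)].

Lemma policy_valueP (K : realType) m r (A : 'M[K]_m) (B : 'M[K]_(m, r))
    (Q : 'M[K]_m) (R : 'M[K]_r) (F : 'M[K]_(r, m)) :
  posdefmx Q -> posdefmx R -> stable (A + B *m F) ->
  let P := policy_value A B Q R F in
  posdefmx P /\
  forall x, qform (lyap (A + B *m F) P) x = - (qform Q x + qform R (F *m x)).
Proof.
move=> pQ pR sF P.
have [sP LP] : P^T = P /\ lyap (A + B *m F) P = - (Q + F^T *m R *m F).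
  have sW : (- (Q + F^T *m R *m F))^T = - (Q + F^T *m R *m F).
    rewrite linearN linearD /= !trmx_mul trmxK (posdef_sym pQ) (posdef_sym pR).
    by rewrite mulmxA.
  have [P0 P0E] := stable_lyap_solve sF sW.
  exact: (@xgetI _ 0 [set P : 'M[K]_m |
    P^T = P /\ lyap (A + B *m F) P = - (Q + F^T *m R *m F)] P0 P0E).
have LE x : qform (lyap (A + B *m F) P) x = - (qform Q x + qform R (F *m x)).
  by rewrite LP bformN bformD bform_mulr bform_mull.
split=> //; apply: psd_ker0_posdef.
  apply: (stable_lyap_psd sF) => // x.
  by rewrite LE oppr_le0 addr_ge0 // posdef_ge0.
move=> x Px; apply/eqP/negP => /negP x0.
have := LE x; rewrite qform_lyap // -(bformC _ _ sP) -[P in bform P]mul1mx bform_mulr Px.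
rewrite bform0r mulr0 => /eqP.
rewrite eq_sym oppr_eq0 gt_eqF // ltr_wpDr ?posdef_ge0 //.
exact: posdef_gt0.
Qed.

Section Iteration.
Variables (K : realType) (m r : nat) (A : 'M[K]_m) (B : 'M[K]_(m, r)).
Variables (Q : 'M[K]_m) (R : 'M[K]_r).
Hypotheses (pQ : posdefmx Q) (pR : posdefmx R).

Let V F := policy_value A B Q R F.
Let T F := gain B R (V F).

(** One step of Kleinman's iteration F |-> T F. The value of F is itself a
    Lyapunov function for the improved loop; comparing both values along this
    loop shows the decrease, and the Riccati defect of the value is a square in
    F - T F, which tends to zero in the limit. *)
Lemma policy_improve F : stable (A + B *m F) ->
  [/\ stable (A + B *m T F), psd (V F - V (T F))
    & forall x, qform (riccati_res A B Q R (V F)) x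
                = - qform R ((F - T F) *m x)].
Proof.
move=> sF; have [pP PE] := policy_valueP pQ pR sF.
rewrite -/(V F) in pP PE.
have sP := posdef_sym pP; have sR := posdef_sym pR; have uR := posdef_unit pR.
have PA x : qform (lyap A (V F)) x - qform R (T F *m x)
      = - qform Q x - qform R ((F - T F) *m x).
  have := PE x; rewrite (@qform_lyap_feedback _ _ _ _ _ _ R F (T F)) ?gainE //.
  by lra.
have PT x : qform (lyap (A + B *m T F) (V F)) x
      = - qform Q x - qform R ((F - T F) *m x) - qform R (T F *m x).
  rewrite (@qform_lyap_feedback _ _ _ _ _ _ R (T F) (T F)) ?gainE // PA.
  by rewrite subrr mul0mx bform0r addr0.
have sT : stable (A + B *m T F).
  exists (V F) => // x x0; rewrite PT.
  have := posdef_gt0 pQ x0; have := posdef_ge0 ((F - T F) *m x) pR.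
  have := posdef_ge0 (T F *m x) pR; lra.
split=> // [|x]; last by rewrite qform_riccati_res // PA; lra.
have [pP' P'E] := policy_valueP pQ pR sT.
apply: (stable_lyap_psd sT) => [|x].
  by rewrite linearB /= sP (posdef_sym pP').
rewrite lyapD lyapN bformD bformN P'E PT.
have := posdef_ge0 ((F - T F) *m x) pR; lra.
Qed.

(** The values of policy iteration decrease and are semidefinite, so they
    converge; the Riccati defect tends to zero along the way. Positive definite
    Q excludes a kernel of the limit. *)
Lemma riccati_exists : (exists F, stable (A + B *m F)) ->
  exists P, posdefmx P /\ riccati A B Q R P.
Proof.
case=> F0 sF0; pose F k := iter k T F0.
have sF k : stable (A + B *m F k).
  by elim: k => // k /policy_improve[].
have pV k : psd (V (F k)).
  by apply: posdef_psd; have [] := policy_valueP pQ pR (sF k).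
have dV k : psd (V (F k) - V (F k.+1)) by have [] := policy_improve (sF k).
have [P pP VP] := psd_decreasing_cvg pV dV.
have sP := proj1 pP; have sR := posdef_sym pR; have uR := posdef_unit pR.
have resP : riccati_res A B Q R P = 0.
  apply: sym_qform_eq0 => [|x]; first exact: tr_riccati_res (posdef_sym pQ) _ _.
  have VP' := mxcvg_shift VP.
  have c k p (M : 'M[K]_(k, p)) : mxcvg (fun=> M) M by apply: mxcvg_cst.
  have cT u M : mxcvg u M -> mxcvg (fun k => gain B R (u k)) (gain B R M).
    by move=> uM; apply: mxcvgN; apply: mxcvgM => //; exact: c.
  have c1 : (fun k => qform (riccati_res A B Q R (V (F k.+1))) x) @ \oo -->
      qform (riccati_res A B Q R P) x.
    apply: mxcvg_bform.
    by do ?[exact: c|exact: VP'|apply: mxcvgD|apply: mxcvgN|apply: mxcvgM].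
  pose D k := F k.+1 - F k.+2.
  have cD : mxcvg D (gain B R P - gain B R P).
    by apply: mxcvgD; [exact: cT|apply: mxcvgN; exact: cT].
  (* The same sequence, seen as minus a square in the gain increments D. *)
  have c2 : (fun k => qform (riccati_res A B Q R (V (F k.+1))) x) @ \oo -->
      qform (- (0^T *m R *m 0)) x.
    rewrite (_ : (fun _ => _) = (fun k => qform (- ((D k)^T *m R *m D k)) x)).
      apply: mxcvg_bform; apply: mxcvgN; rewrite -(subrr (gain B R P)).
      apply: mxcvgM => //; apply: mxcvgM; last exact: c.
      exact: mxcvg_tr.
    apply/funext => k; have [_ _ ->] := policy_improve (sF k.+1).
    by rewrite bformN bform_mulr bform_mull.
  by rewrite -(cvg_unique _ c2 c1) // mulmx0 oppr0 bform0.
exists P; split=> //; apply: psd_ker0_posdef => // x Px.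
apply/eqP/negP => /negP x0; have := posdef_gt0 pQ x0.
suff -> : qform Q x = 0 by rewrite ltxx.
have := qform_riccati_res A B Q x sR uR sP.
rewrite resP bform0 qform_lyap // -(bformC _ _ sP).
have -> : gain B R P *m x = 0 by rewrite /gain mulNmx -!mulmxA Px !mulmx0 oppr0.
rewrite -[P in bform P]mul1mx bform_mulr Px.
by rewrite !bform0r mulr0 subr0 add0r.
Qed.
End Iteration.

(** * Block decomposition of the inputs *)

Section Blocks.
Variables (K : realType) (n : nat) (rs : 'I_n -> nat).
Notation Pi i := (block_inj K rs i).
Notation S i := (block_compl K rs i).

Lemma tr_block_inj_mul m (X : 'M[K]_(\sum_j rs j, m)) i :
  (Pi i)^T *m X = submxcol X i.
Proof. by rewrite tr_submxrow trmx1 submxcol_mul mul1mx. Qed.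

Lemma mul_block_inj m (X : 'M[K]_(m, \sum_j rs j)) i :
  X *m Pi i = submxrow X i.
Proof. by rewrite /block_inj mul_submxrow mulmx1. Qed.

Lemma block_inj_orth i j : i != j -> (Pi i)^T *m Pi j = 0.
Proof. by move=> ij; rewrite tr_block_inj_mul block_inj_offdiag. Qed.

Lemma sum_block_proj : \sum_i Pi i *m (Pi i)^T = 1%:M.
Proof.
transitivity ((\mxrow_i Pi i) *m (\mxcol_i (Pi i)^T)).
  by rewrite mul_mxrow_mxcol.
by rewrite -tr_mxrow submxrowK trmx1 mulmx1.
Qed.

Lemma tr_block_compl i : (S i)^T = S i.
Proof. by rewrite /block_compl linearB /= trmx1 trmx_mul trmxK. Qed.

Lemma tr_block_inj_compl i : (Pi i)^T *m S i = 0.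
Proof. by rewrite /block_compl mulmxBr mulmx1 mulmxA block_injK mul1mx subrr. Qed.

Lemma block_compl_inj i : S i *m Pi i = 0.
Proof. by rewrite -[LHS]trmxK trmx_mul tr_block_compl tr_block_inj_compl trmx0. Qed.

Lemma tr_block_inj_compl_neq i j : i != j -> (Pi i)^T *m S j = (Pi i)^T.
Proof.
by move=> ij; rewrite /block_compl mulmxBr mulmx1 mulmxA block_inj_orth // mul0mx subr0.
Qed.

Lemma block_decomp m (X : 'M[K]_(\sum_j rs j, m)) i :
  X = Pi i *m ((Pi i)^T *m X) + S i *m X.
Proof. by rewrite /block_compl mulmxBl mul1mx mulmxA addrC subrK. Qed.

Lemma block_ext m (X Y : 'M[K]_(\sum_j rs j, m)) :
  (forall i, (Pi i)^T *m X = (Pi i)^T *m Y) -> X = Y.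
Proof.
move=> XY; rewrite -[X]mul1mx -[Y]mul1mx -sum_block_proj !mulmx_suml.
by apply: eq_bigr => i _; rewrite -!mulmxA XY.
Qed.

Lemma block_diagonal_inj (R : 'M[K]_(\sum_j rs j)) i :
  block_diagonal R -> R *m Pi i = Pi i *m subR R i.
Proof.
case=> D ->; apply: block_ext => j; rewrite [RHS]mulmxA.
have [->|ji] := eqVneq j i.
  by rewrite block_injK mul1mx /subR -mulmxA.
rewrite block_inj_orth // mul0mx mul_block_inj tr_block_inj_mul -submxblockEh.
by rewrite mxblockK (negPf ji).
Qed.

(** Block i of the input and the remaining blocks are R-orthogonal. *)
Lemma block_diagonal_compl (R : 'M[K]_(\sum_j rs j)) i u v :
  block_diagonal R -> R^T = R -> bform R (S i *m u) (Pi i *m v) = 0.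
Proof.
move=> dR sR; rewrite -bform_mulr block_diagonal_inj // -bform_mull.
by rewrite tr_block_compl mulmxA block_compl_inj mul0mx bform0.
Qed.

Lemma posdef_subR (R : 'M[K]_(\sum_j rs j)) i : posdefmx R -> posdefmx (subR R i).
Proof.
move=> pR; split=> [|x x0].
  by rewrite /subR !trmx_mul trmxK posdef_sym // mulmxA.
rewrite -[X in _ < X]/(qform (subR R i) x) /subR bform_mulr bform_mull.
apply: posdef_gt0 => //; apply: contra x0 => /eqP Px.
by rewrite -[x]mul1mx -(block_injK K rs i) -mulmxA Px mulmx0.
Qed.

Lemma qform_subQ m (Q : 'M[K]_m) (R : 'M[K]_(\sum_j rs j)) i F x :
  qform (subQ Q R i F) x = qform Q x + qform R (S i *m F *m x).
Proof.
rewrite /subQ bformD -!mulmxA bform_mull -{1}tr_block_compl bform_mull.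
by rewrite bform_mulr -!mulmxA.
Qed.

Lemma posdef_subQ m (Q : 'M[K]_m) (R : 'M[K]_(\sum_j rs j)) i F :
  posdefmx Q -> posdefmx R -> posdefmx (subQ Q R i F).
Proof.
move=> pQ pR; split=> [|x x0].
  rewrite /subQ linearD /= !trmx_mul trmxK tr_block_compl !posdef_sym //.
  by rewrite !mulmxA.
rewrite -[X in _ < X]/(qform (subQ Q R i F) x) qform_subQ.
by rewrite ltr_wpDr ?posdef_ge0 ?posdef_gt0.
Qed.

Lemma qform_block_split (R : 'M[K]_(\sum_j rs j)) i u v :
  block_diagonal R -> R^T = R ->
  qform R (Pi i *m u + S i *m v) = qform (subR R i) u + qform R (S i *m v).
Proof.
move=> dR sR; rewrite qform_expand // (bformC (Pi i *m u)) //.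
rewrite block_diagonal_compl // mulr0 addr0.
by rewrite /subR bform_mulr bform_mull.
Qed.

(** For gains H that agree with F outside block i, the closed loop A + BH is the
    loop of subsystem i with gain Pi_i^T H, and the costs of subsystem i and of
    the whole system agree. So [riccati_feedback] for the subsystem turns into a
    statement about H and F', written with the data of the whole system. *)
Lemma split_update_feedback m (A : 'M[K]_m) (B : 'M[K]_(m, \sum_j rs j))
    (Q : 'M[K]_m) (R : 'M[K]_(\sum_j rs j)) i (F : 'M[K]_(\sum_j rs j, m)) :
  posdefmx Q -> posdefmx R -> block_diagonal R -> stable (A + B *m F) ->
  let P := riccati_sol (subA A B i F) (subB B i) (subQ Q R i F) (subR R i) in
  let F' := split_update A B Q R i F in
  posdefmx P /\ forall H x, S i *m H = S i *m F ->
    qform (lyap (A + B *m H) P) x =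
      qform R ((H - F') *m x) - qform Q x - qform R (H *m x).
Proof.
move=> pQ pR dR sF P F'; have sR := posdef_sym pR.
have AE H : S i *m H = S i *m F ->
    A + B *m H = subA A B i F + subB B i *m ((Pi i)^T *m H).
  move=> SH; rewrite {1}(block_decomp H i) SH /subA /subB mulmxDr.
  by rewrite -!mulmxA addrA addrAC.
have [pP PE] : posdefmx P /\
    riccati (subA A B i F) (subB B i) (subQ Q R i F) (subR R i) P.
  have [|P0 P0E] := @riccati_exists _ _ _ (subA A B i F) (subB B i) _ _
    (posdef_subQ i F pQ pR) (posdef_subR i pR).
    by exists ((Pi i)^T *m F); rewrite -AE.
  exact: (@xgetI _ 0 [set P : 'M[K]_m | posdefmx P /\
    riccati (subA A B i F) (subB B i) (subQ Q R i F) (subR R i) P]%classic P0 P0E).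
split=> // H x SH; rewrite AE // (riccati_feedback _ _ (posdef_subR i pR) _ PE); last exact: posdef_sym.
rewrite qform_subQ.
have -> : qform R (H *m x) = qform (subR R i) ((Pi i)^T *m H *m x) + qform R (S i *m F *m x).
  rewrite {1 2}(block_decomp H i) SH mulmxDl -!mulmxA.
  by rewrite qform_block_split // !mulmxA.
have -> : (H - F') *m x = Pi i *m (((Pi i)^T *m H - gain (subB B i) (subR R i) P) *m x) + S i *m 0.
  rewrite mulmx0 addr0 mulmxA; congr (_ *m _).
  rewrite {1}(block_decomp H i) SH /F' /split_update /sub_gain /lqr_gain -/P -/(gain _ _ _).
  by rewrite opprD addrACA subrr addr0 mulmxBr.
rewrite qform_block_split // mulmx0 bform0r addr0.
ring.
Qed.

End Blocks.

(** * One update near the optimal gain *)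

Section Local.
Variables (K : realType) (n : nat) (rs : 'I_n -> nat) (m : nat).
Variables (A : 'M[K]_m) (B : 'M[K]_(m, \sum_j rs j)) (Q : 'M[K]_m).
Variables (R : 'M[K]_(\sum_j rs j)) (P : 'M[K]_m).
Hypotheses (pQ : posdefmx Q) (pR : posdefmx R) (dR : block_diagonal R).
Hypotheses (pP : posdefmx P) (ricP : riccati A B Q R P).
Notation Pi i := (block_inj K rs i).
Notation S i := (block_compl K rs i).
Let Fo := gain B R P.

(** The radius d makes (F - Fo)^T R (F - Fo) at most half of Q, uniformly in the
    subsystem i. Write P' for the Riccati solution of that subsystem and F' for
    the updated gain. Both bounds on P' - P are instances of [stable_lyap_psd]: the
    lower one along the loop A + BF', where P' is a certificate, and the upper one
    along A + BF, where P is a certificate. *)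
Lemma sub_value_quadratic : exists2 d, 0 < d & exists2 C, 0 <= C &
  forall F, `|F - Fo| < d -> stable (A + B *m F) /\ forall i,
    `|riccati_sol (subA A B i F) (subB B i) (subQ Q R i F) (subR R i) - P|
      <= C * `|F - Fo| ^+ 2.
Proof.
have [q q0 qQ] := posdef_lower pQ.
pose r : nat := \sum_j rs j.
pose c := (m * m)%:R * (r%:R * r%:R * `|R|) + 1.
have c0 : 0 < c by rewrite ltr_wpDl // !mulr_ge0.
have sP := posdef_sym pP.
have err F x : qform R ((F - Fo) *m x) <= c * `|F - Fo| ^+ 2 * qform 1%:M x.
  rewrite (le_trans (qform_image_le _ _ _)) // ler_wpM2r ?posdef_ge0 //.
    exact: posdef1.
  by rewrite ler_wpM2r ?sqr_ge0 // lerDl.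
pose d := Num.min 1 (q / (2 * c)).
have d0 : 0 < d by rewrite lt_min ltr01 divr_gt0 // mulr_gt0.
exists d => //.
exists (2 * c / q * ((m * m)%:R * `|P|)).
  by rewrite !mulr_ge0 // ?invr_ge0 ltW.
move=> F Fd; set e := `|F - Fo|.
have e0 : 0 <= e by exact: normr_ge0.
have ce : c * e ^+ 2 <= q / 2.
  have [e1 eq] : e <= 1 /\ e <= q / (2 * c).
    by move: Fd; rewrite -/e lt_min => /andP[/ltW ? /ltW ?].
  rewrite ler_pdivlMr ?mulr_gt0 // in eq.
  have : e ^+ 2 <= e by rewrite expr2 ler_piMr.
  nra.
have PF x : qform (lyap (A + B *m F) P) x <= - (q / 2) * qform 1%:M x.
  rewrite (riccati_feedback _ _ pR sP ricP) -/Fo.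
  have := err F x; have := qQ x; have := posdef_ge0 (F *m x) pR.
  have := posdef_ge0 x (posdef1 K m).
  rewrite -/e; move: ce; set w := qform 1%:M x; set a := c * _.
  set RF := qform R (F *m x); set RD := qform R _; nra.
have sF : stable (A + B *m F).
  exists P => // x x0; apply: le_lt_trans (PF x) _.
  by rewrite mulNr oppr_lt0 mulr_gt0 ?divr_gt0 ?posdef_gt0 //; apply: posdef1.
split=> // i.
have [] := split_update_feedback i pQ pR dR sF.
set P' := riccati_sol _ _ _ _; set F' := split_update _ _ _ _ _ _ => pP' P'E.
have SF' : S i *m F' = S i *m F by have [] := (split_updateP A B Q R i F F').1 erefl.
have sF' : stable (A + B *m F').
  exists P' => // x x0; rewrite P'E // subrr mul0mx bform0r.
  by have := posdef_gt0 pQ x0; have := posdef_ge0 (F' *m x) pR; lra.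
have sP' := posdef_sym pP'.
have pD : psd (P' - P).
  apply: (stable_lyap_psd sF') => [|x]; first by rewrite linearB /= sP sP'.
  rewrite lyapD lyapN bformD bformN P'E // (riccati_feedback _ _ pR sP ricP) -/Fo.
  rewrite subrr mul0mx bform0r.
  by have := posdef_ge0 ((F' - Fo) *m x) pR; lra.
(* A + BF decreases P at least at the rate q / 2, so t P absorbs the error
   c e^2 made by P in the loop A + BF. *)
pose t := 2 * c * e ^+ 2 / q.
have t0 : 0 <= t by rewrite !mulr_ge0 // ?invr_ge0 ltW.
have pT : psd (t *: P - (P' - P)).
  apply: (stable_lyap_psd sF) => [|x].
    by rewrite !linearB linearZ /= sP sP'.
  rewrite lyapD lyapN lyapZ lyapD lyapN.
  rewrite bformD bformN bformZ (bformD (lyap _ P')) bformN P'E //.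
  have := ler_wpM2l t0 (PF x).
  rewrite {3}(riccati_feedback _ _ pR sP ricP) -/Fo.
  have -> : t * (- (q / 2) * qform 1%:M x) = - (c * e ^+ 2 * qform 1%:M x).
    by rewrite /t; field; rewrite gt_eqF.
  have := err F x; have := posdef_ge0 ((F - F') *m x) pR; rewrite -/e; lra.
have := @psd_norm_le _ _ _ (t * ((m * m)%:R * `|P|)) _ pD.
rewrite (_ : t * _ = 2 * c / q * ((m * m)%:R * `|P|) * e ^+ 2); last first.
  by rewrite /t; ring.
apply; first by rewrite !mulr_ge0 // ?invr_ge0 ?ltW.
move=> x; have := proj2 pT x; rewrite (bformD (t *: P)) (bformN (P' - P)) subr_ge0 bformZ.
move/le_trans; apply.
rewrite (_ : _ * qform 1%:M x = t * ((m * m)%:R * `|P| * qform 1%:M x)); last first.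
  by rewrite /t; ring.
by rewrite ler_wpM2l // (le_trans (ler_norm _)) // qform_norm_le.
Qed.

(** Block i of the optimal gain is the same function of P as the updated block
    is of P'. Here the block structure of R is essential:
    Pi_i^T R^-1 = (Pi_i^T R Pi_i)^-1 Pi_i^T. *)
Lemma tr_block_inj_gain i : 
  (Pi i)^T *m Fo = gain (subB B i) (subR R i) P.
Proof.
have uR := posdef_unit pR; have uRi := posdef_unit (posdef_subR i pR).
rewrite /Fo /gain !mulmxN /subB trmx_mul !mulmxA; congr (- (_ *m _ *m _)).
have RP := block_diagonal_inj i dR.
apply: trmx_inj; rewrite !trmx_mul !trmx_inv trmxK posdef_sym // posdef_sym; last exact: posdef_subR.
by rewrite -[Pi i in RHS](mulKmx uR) RP -mulmxA mulmxK.
Qed.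

Lemma split_update_quadratic : exists2 d, 0 < d & exists2 C, 0 <= C &
  forall F, `|F - Fo| < d -> forall i,
    `|Pi i *m (Pi i)^T *m (split_update A B Q R i F - Fo)|
      <= C * `|F - Fo| ^+ 2.
Proof.
have [d d0 [C C0 H]] := sub_value_quadratic.
exists d => //.
pose G i := Pi i *m (invmx (subR R i) *m (subB B i)^T).
exists ((\sum_i m%:R * `|G i|) * C).
  by rewrite mulr_ge0 // sumr_ge0 // => i _; rewrite mulr_ge0.
move=> F Fd i; have [_ /(_ i)] := H F Fd.
set P' := riccati_sol _ _ _ _ => HP.
have -> : Pi i *m (Pi i)^T *m (split_update A B Q R i F - Fo) = - (G i *m (P' - P)).
  have [E _] := (split_updateP A B Q R i F (split_update A B Q R i F)).1 erefl.
  rewrite -mulmxA mulmxBr E tr_block_inj_gain /sub_gain /lqr_gain -/P' /gain.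
  by rewrite opprK addrC -mulmxBr -[P - P']opprB !mulmxN /G !mulmxA.
rewrite normrN (le_trans (mx_normM _ _)) // -[leRHS]mulrA.
apply: ler_pM; rewrite ?mulr_ge0 //.
by apply: (le_sum_term (F := fun i => m%:R * `|G i|)) => j; rewrite mulr_ge0.
Qed.
End Local.

(** * Equivalence of norms *)

(** A norm is Lipschitz for the maximum norm, hence continuous, and attains a
    positive minimum on the compact unit sphere. *)
Lemma mx_norm_equiv (K : realType) r m (N : 'M[K]_(r, m) -> K) : is_norm N ->
  (exists2 c, 0 < c & forall X, N X <= c * `|X|) /\
  (exists2 c, 0 < c & forall X, `|X| <= c * N X).
Proof.
move=> [N_eq0 NZ ND].
have N0 : N 0 = 0 by rewrite -(scale0r 0) NZ normr0 mul0r.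
have NN X : N (- X) = N X by rewrite -scaleN1r NZ normrN1 mul1r.
have N_ge0 X : 0 <= N X.
  by have := ND X (- X); rewrite subrr N0 NN; lra.
have Nsum (I : Type) (s : seq I) (F : I -> 'M[K]_(r, m)) :
    N (\sum_(i <- s) F i) <= \sum_(i <- s) N (F i).
  elim: s => [|i s IH]; first by rewrite !big_nil N0.
  by rewrite !big_cons (le_trans (ND _ _)) // lerD2l.
have [c c0 Nc] : exists2 c, 0 < c & forall X, N X <= c * `|X|.
  exists (\sum_i \sum_j N (delta_mx i j) + 1).
    by rewrite ltr_wpDl // sumr_ge0 // => i _; rewrite sumr_ge0.
  move=> X; rewrite mulrDl mul1r ler_wpDr // {1}[X]matrix_sum_delta.
  rewrite (le_trans (Nsum _ _ _)) // mulr_suml ler_sum // => i _.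
  rewrite (le_trans (Nsum _ _ _)) // mulr_suml ler_sum // => j _.
  by rewrite NZ mulrC ler_wpM2l // le_mx_norm_entry.
split; first by exists c.
pose f (v : 'rV[K]_(r * m)) := N (vec_mx v).
have vec_le (v : 'rV[K]_(r * m)) : `|vec_mx v| <= `|v|.
  by apply: mx_norm_le => // i j; rewrite mxE le_mx_norm_entry.
have le_vec (X : 'M[K]_(r, m)) : `|X| <= `|mxvec X|.
  by apply: mx_norm_le => // i j; rewrite -mxvecE le_mx_norm_entry.
have flip u v : `|f u - f v| <= c * `|u - v|.
  have h x y : f x - f y <= c * `|x - y|.
    have := ND (vec_mx (x - y)) (vec_mx y).
    rewrite -linearD subrK -/(f x) -/(f y) -lerBlDr => /le_trans; apply.
    by rewrite (le_trans (Nc _)) // ler_wpM2l // ltW.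
  by rewrite ler_norml h andbT lerNl opprB distrC h.
have cf : continuous f.
  move=> u; have FF := nbhs_filter u; apply/cvgrPdist_lt => e e0.
  apply/(@nbhs_ballP _ _ (u : 'rV[K]_(r * m))); exists (e / c) => /=; first exact: divr_gt0.
  move=> v; rewrite -ball_normE /= ltr_pdivlMr // mulrC.
  exact: le_lt_trans (flip _ _).
(* The sphere is empty when the matrices have no entries. *)
have [[v0 v00]|nv] := pselect (exists v0 : 'rV[K]_(r * m), v0 != 0); last first.
  exists 1 => // X; suff -> : X = 0 by rewrite normr0 N0 mulr0.
  apply: (can_inj mxvecK); rewrite linear0; apply/eqP/negP => /negP X0.
  by apply: nv; exists (mxvec X).
pose A := [set v : 'rV[K]_(r * m) | `|v| = 1]%classic.
have unit v : v != 0 -> A (`|v|^-1 *: v).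
  by move=> vn0; rewrite /A /= normrZ normfV normr_id mulVf // normr_eq0.
have cA : compact A.
  apply: bounded_closed_compact.
    by exists 1; split=> // x x1 v /= ->; exact: ltW.
  have -> : A = ((fun v : 'rV[K]_(r * m) => `|v|) @^-1` [set 1 : K])%classic by [].
  apply: preimage_closed; last exact: closed_eq.
  by move=> x _; exact: norm_continuous.
have [v1 Av1 fmin] : exists2 v1, A v1 & forall v, A v -> f v1 <= f v.
  have [|v1 Av1 fmin] := @EVT_min_rV _ _ f A _ cA (continuous_subspaceT cf).
    by exists (`|v0|^-1 *: v0); exact: unit.
  by exists v1; [rewrite inE in Av1|move=> v Av; apply: fmin; rewrite inE].
have f1 : 0 < f v1.
  rewrite lt_neqAle N_ge0 andbT eq_sym; apply/eqP => /N_eq0 v10.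
  have : `|v1| = 1 by exact: Av1.
  by rewrite -[v1]vec_mxK v10 linear0 normr0 => /esym/eqP; rewrite oner_eq0.
exists (f v1)^-1; first by rewrite invr_gt0.
move=> X; rewrite mulrC ler_pdivlMr //.
have [X0|X0] := eqVneq (mxvec X) 0.
  by rewrite (le_trans (ler_wpM2r (ltW f1) (le_vec X))) // X0 normr0 mul0r.
rewrite (le_trans (ler_wpM2r (ltW f1) (le_vec X))) //.
have := fmin _ (unit _ X0); rewrite /f linearZ /= mxvecK NZ normfV normr_id.
by rewrite mulrC ler_pdivlMr ?normr_gt0 // mulrC.
Qed.

(** * One full cycle of updates *)

Lemma val_iter_ordS n (i : 'I_n) k : iter k (@ordS n) i = ((i + k) %% n)%N :> nat.
Proof.
elim: k => [|k IH]; first by rewrite addn0 modn_small.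
by rewrite iterS /= IH -addn1 modnDml addn1 addnS.
Qed.

(** A cycle visits each subsystem once, whatever the step k at which it
    starts. *)
Lemma iter_ordS_inj n (i : 'I_n) k : injective (fun l : 'I_n => iter (k + l)%N (@ordS n) i).
Proof.
move=> l j /(congr1 (@nat_of_ord n)); rewrite !val_iter_ordS !addnA => /eqP.
by rewrite eqn_modDl !modn_small // => /eqP/val_inj.
Qed.

Section Cycle.
Variables (K : realType) (n : nat) (rs : 'I_n -> nat) (m : nat).
Variables (A : 'M[K]_m) (B : 'M[K]_(m, \sum_j rs j)) (Q : 'M[K]_m).
Variables (R : 'M[K]_(\sum_j rs j)) (Fo : 'M[K]_(\sum_j rs j, m)).
Notation Pi i := (block_inj K rs i).
Notation S i := (block_compl K rs i).

(** A single update enlarges the error at most by a constant factor M, so the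
    radius d / M^n keeps all n steps of a cycle within the reach of the estimate
    for one update. A block has a second-order error once it has been updated,
    and it keeps this error until the end of the cycle. *)
Lemma cycle_quadratic (d C : K) : 0 < d -> 0 <= C ->
  (forall F, `|F - Fo| < d -> forall i,
    `|Pi i *m (Pi i)^T *m (split_update A B Q R i F - Fo)|
      <= C * `|F - Fo| ^+ 2) ->
  exists2 d', 0 < d' & exists2 C', 0 < C' & forall F0 i k,
    `|split_iter A B Q R i F0 k - Fo| < d' ->
    `|split_iter A B Q R i F0 (k + n) - Fo|
      <= C' * `|split_iter A B Q R i F0 k - Fo| ^+ 2.
Proof.
move=> d0 C0 H.
pose s := \sum_i (\sum_j rs j)%:R * `|S i|.
have s0 : 0 <= s by rewrite sumr_ge0 // => i _; rewrite mulr_ge0.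
pose M := C * d + s + 1.
have M1 : 1 <= M by rewrite lerDr addr_ge0 // mulr_ge0 // ltW.
have M0 : 0 < M by exact: lt_le_trans M1.
pose d' := d / M ^+ n.
exists d'; first by rewrite divr_gt0 // exprn_gt0.
exists (n%:R * (C * (M ^+ n) ^+ 2) + 1).
  by rewrite ltr_wpDl // mulr_ge0 // mulr_ge0 // sqr_ge0.
move=> F0 i k; set e := `|_ - Fo| => ed.
have e0 : 0 <= e by exact: normr_ge0.
pose E j := split_iter A B Q R i F0 (k + j) - Fo.
pose p j := iter (k + j) (@ordS n) i.
have SE j : S (p j) *m E j.+1 = S (p j) *m E j.
  rewrite /E addnS /= !mulmxBr; congr (_ - _).
  by have [] := (split_updateP A B Q R (p j) (split_iter A B Q R i F0 (k + j)) _).1 erefl.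
have keep j q : q != p j -> (Pi q)^T *m E j.+1 = (Pi q)^T *m E j.
  by move=> qp; rewrite -(tr_block_inj_compl_neq K rs qp) -!mulmxA SE.
have step j : `|E j| < d ->
    `|Pi (p j) *m (Pi (p j))^T *m E j.+1| <= C * `|E j| ^+ 2.
  by move=> Ed; rewrite /E addnS; exact: H.
have grow j : `|E j| < d -> `|E j.+1| <= M * `|E j|.
  move=> Ed; rewrite {1}(block_decomp (E j.+1) (p j)) SE mulmxA.
  rewrite (le_trans (ler_normD _ _)) // /M mulrDl mul1r ler_wpDr // mulrDl.
  apply: lerD.
    apply: (le_trans (step _ Ed)).
    by rewrite -mulrA expr2 ler_wpM2l // ler_wpM2r // ltW.
  rewrite (le_trans (mx_normM _ _)) // ler_wpM2r //.
  apply: (le_sum_term (F := fun i => (\sum_j rs j)%:R * `|S i|)) => q.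
  by rewrite mulr_ge0.
have small j : (j <= n)%N -> `|E j| <= M ^+ j * e /\ `|E j| < d.
  elim: j => [|j IH] jn.
    rewrite /E addn0 -/e expr0 mul1r; split=> //.
    apply: lt_le_trans ed _; rewrite /d' ler_pdivrMr ?exprn_gt0 //.
    by rewrite ler_peMr ?(ltW d0) // exprn_ege1.
  have [Ej Ejd] := IH (ltnW jn).
  have le : `|E j.+1| <= M ^+ j.+1 * e.
    by rewrite (le_trans (grow _ Ejd)) // exprS -mulrA ler_wpM2l // ltW.
  split=> //; apply: le_lt_trans le _.
  rewrite mulrC -ltr_pdivlMr ?exprn_gt0 //; apply: lt_le_trans ed _.
  rewrite /d' ler_wpM2l ?(ltW d0) // lef_pV2 ?posrE ?exprn_gt0 //.
  by rewrite ler_weXn2l.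
pose c := C * (M ^+ n) ^+ 2 * e ^+ 2.
have blk j : (j <= n)%N -> forall l, (l < j)%N ->
    `|Pi (p l) *m (Pi (p l))^T *m E j| <= c.
  elim: j => // j IH jn l; rewrite ltnS leq_eqVlt => /orP[/eqP ->|lj].
    have [Ej Ejd] := small j (ltnW jn).
    rewrite (le_trans (step _ Ejd)) // /c -mulrA ler_wpM2l // -exprMn.
    rewrite lerXn2r ?nnegrE ?mulr_ge0 ?exprn_ge0 ?(ltW M0) //.
    rewrite (le_trans Ej) // ler_wpM2r // ler_weXn2l //.
    exact: ltnW.
  rewrite -mulmxA keep ?mulmxA; first exact: IH (ltnW jn) _ lj.
  apply/negP => /eqP pp.
  have ln : (l < n)%N by exact: ltn_trans lj jn.
  have := @iter_ordS_inj n i k (Ordinal ln) (Ordinal jn) pp.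
  by move=> /(congr1 val) /= lj'; rewrite lj' ltnn in lj.
rewrite -/(E n) -[E n]mul1mx -(sum_block_proj K rs) mulmx_suml.
rewrite (le_trans (ler_norm_sum _ _ _)) // mulrDl mul1r ler_wpDr ?sqr_ge0 //.
rewrite -mulrA sum_ord_le // => q.
have [g _ gK] := injF_bij (@iter_ordS_inj n i k).
have := blk n (leqnn n) (g q) (ltn_ord _).
by rewrite /p gK.
Qed.
End Cycle.

(** * Local quadratic convergence *)

Theorem theorem6 (K : realType) (n : nat) (ms rs : 'I_n -> nat)
    (A : 'M[K]_(\sum_j ms j)) (B : 'M[K]_(\sum_j ms j, \sum_j rs j))
    (Q : 'M[K]_(\sum_j ms j)) (R : 'M[K]_(\sum_j rs j))
    (N : 'M[K]_(\sum_j rs j, \sum_j ms j) -> K)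
    (Qpos : posdefmx Q) (Qdiag : block_diagonal Q)
    (Rpos : posdefmx R) (Rdiag : block_diagonal R)
    (ctrb : exists (i : 'I_n) (F : 'M[K]_(\sum_j rs j, \sum_j ms j)),
      controllable (subA A B i F) (subB B i))
    (normN : is_norm N) :
  exists delta C : K, [/\ 0 < delta, 0 < C &
    forall (F0 : 'M[K]_(\sum_j rs j, \sum_j ms j)) (i : 'I_n),
      controllable (subA A B i F0) (subB B i) ->
      forall k : nat,
        N (split_iter A B Q R i F0 k - lqr_gain A B Q R) < delta ->
        N (split_iter A B Q R i F0 (k + n) - lqr_gain A B Q R)
          <= C * N (split_iter A B Q R i F0 k - lqr_gain A B Q R) ^+ 2].
Proof.
have [P0 [pP0 ricP0]] : exists P, posdefmx P /\ riccati A B Q R P.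
  apply: riccati_exists => //.
  have [i [F /controllable_stabilizable[G sG]]] := ctrb.
  exists (block_compl K rs i *m F + block_inj K rs i *m G).
  by rewrite mulmxDr !mulmxA addrA.
pose P := riccati_sol A B Q R.
have [pP ricP] : posdefmx P /\ riccati A B Q R P.
  exact: (@xgetI _ 0 [set P | posdefmx P /\ riccati A B Q R P]%classic P0
    (conj pP0 ricP0)).
have [d d0 [C C0 step]] := split_update_quadratic Qpos Rpos Rdiag pP ricP.
have [d' d'0 [C' C'0 cycle]] := cycle_quadratic d0 C0 step.
have [[a a0 Na] [b b0 Nb]] := mx_norm_equiv normN.
exists (d' / b), (a * (C' * b ^+ 2)); split.
- exact: divr_gt0.
- by rewrite !mulr_gt0 // exprn_gt0.
move=> F0 i _ k; rewrite ltr_pdivlMr // mulrC => close.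
apply: le_trans (Na _) _; rewrite -[leRHS]mulrA ler_wpM2l ?(ltW a0) //.
apply: le_trans (cycle F0 i k (le_lt_trans (Nb _) close)) _.
rewrite -[leRHS]mulrA ler_wpM2l ?(ltW C'0) // -exprMn.
by rewrite lerXn2r // nnegrE // (le_trans _ (Nb _)).
Qed.
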